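(* Let $\mathbb{K}$ be a field of characteristic $0$ and let $(\mathcal{A},\mu)$ be a $3$-dimensional $\mathbb{K}$-algebra whose multiplication $\mu:\mathcal{A}\times\mathcal{A}\to\mathcal{A}$ is bilinear and skew-symmetric. Then $(\mathcal{A},\mu)$ is a Hom-Lie algebra, i.e. there exists a nonzero linear endomorphism $f:\mathcal{A}\to\mathcal{A}$ such that $$\mu(\mu(x,y),f(z))+\mu(\mu(y,z),f(x))+\mu(\mu(z,x),f(y))=0\quad\text{for all }x,y,z\in\mathcal{A}.$$
   Context: An algebra over $\mathbb{K}$ is a pair $(\mathcal{A},\mu)$ where $\mathcal{A}$ is a $\mathbb{K}$-vector space and $\mu:\mathcal{A}\times\mathcal{A}\to\mathcal{A}$ is a bilinear map (no associativity or Jacobi identity is assumed). It is skew-symmetric if $\mu(x,y)=-\mu(y,x)$ for all $x,y$. A skew-symmetric algebra $(\mathcal{A},\mu)$ is called a Hom-Lie algebra if it admits a nonzero linear endomorphism $f$ satisfying the Hom-Jacobi identity $\mu(\mu(x,y),f(z))+\mu(\mu(y,z),f(x))+\mu(\mu(z,x),f(y))=0$ for all $x,y,z\in\mathcal{A}$. *)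

(* Defs.v *)
From mathcomp Require Import all_boot all_algebra.

Set Implicit Arguments.
Unset Strict Implicit.
Unset Printing Implicit Defensive.

Import GRing.Theory.
Local Open Scope ring_scope.

Definition skew_symmetric (K : fieldType) (A : vectType K)
    (mu : {bilinear A -> A -> A}) : Prop :=
  forall x y : A, mu x y = - mu y x.

Definition hom_jacobi (K : fieldType) (A : vectType K)
    (mu : {bilinear A -> A -> A}) (f : 'End(A)) : Prop :=
  forall x y z : A,
    mu (mu x y) (f z) + mu (mu y z) (f x) + mu (mu z x) (f y) = 0.

Definition hom_lie (K : fieldType) (A : vectType K)
    (mu : {bilinear A -> A -> A}) : Prop :=
  skew_symmetric mu /\ exists f : 'End(A), f != 0 /\ hom_jacobi mu f.

(* Main.v *)
Require Import Defs.
From HB Require Import structures.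
From mathcomp Require Import all_boot all_algebra.
From mathcomp Require Import ring.

Set Implicit Arguments.
Unset Strict Implicit.
Unset Printing Implicit Defensive.

Import GRing.Theory.
Local Open Scope ring_scope.

(** The twist [f] can be taken of rank one.  For [f x = phi x *: v], with [phi]
    a linear form and [v] a vector, linearity of [mu] in its second argument
    turns the left-hand side of the Hom-Jacobi identity into [mu w v], where
    [w = phi z *: mu x y + phi x *: mu y z + phi y *: mu z x].  This [w] is the
    value at [(x, y, z)] of the alternating 3-form [phi /\ mu], and on a space
    of dimension 3 all values of such a form lie on one line (lemma
    [wedge_coord0]).  Taking [v] to span that line, or any nonzero vector when
    the form vanishes, makes [mu w v] a multiple of [mu v v], which is [0].

    The form [phi] used below is the first coordinate in a basis
    [(e0, e1, e2)], for which the line is spanned by [mu e1 e2].  The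
    characteristic enters only in passing from [mu v v = - mu v v] to
    [mu v v = 0]. *)

Lemma skew_diag (K : fieldType) (A : vectType K) (mu : {bilinear A -> A -> A}) :
  2%:R != 0 :> K -> skew_symmetric mu -> forall x, mu x x = 0.
Proof.
move=> K2 skew x; have /eqP := skew x x.
rewrite -addr_eq0 -mulr2n -scaler_nat scaler_eq0 (negPf K2).
by move/eqP.
Qed.

(** This reduces an equation between linear combinations of vectors to equations
    between scalars, on which [ring] applies. *)
Lemma vect_eq_coord (K : fieldType) (A : vectType K) (u v : A) :
  (forall phi : {scalar A}, phi u = phi v) -> u = v.
Proof.
move=> eq_uv; rewrite (coord_vbasis (memvf u)) (coord_vbasis (memvf v)).
by apply: eq_bigr => i _; rewrite (eq_uv (coord (vbasis {:A}) i)).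
Qed.

Lemma skew_expand3 (K : fieldType) (A : vectType K)
    (mu : {bilinear A -> A -> A}) :
    skew_symmetric mu -> (forall x, mu x x = 0) ->
  forall (e0 e1 e2 : A) (a0 a1 a2 b0 b1 b2 : K),
  mu (a0 *: e0 + a1 *: e1 + a2 *: e2) (b0 *: e0 + b1 *: e1 + b2 *: e2) =
    (a0 * b1 - a1 * b0) *: mu e0 e1 + (a0 * b2 - a2 * b0) *: mu e0 e2
    + (a1 * b2 - a2 * b1) *: mu e1 e2.
Proof.
move=> skew diag e0 e1 e2 a0 a1 a2 b0 b1 b2.
rewrite !(linearDl, linearDr, linearZl_LR, linearZr_LR) /=.
rewrite !diag (skew e1 e0) (skew e2 e0) (skew e2 e1).
apply: vect_eq_coord => phi; rewrite !(linearD phi, linearN phi, scalarZ phi).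
rewrite (linear0 phi); ring.
Qed.

(** The left-hand side is the value at [(x, y, z)] of [phi /\ mu], where [phi]
    is the first coordinate.  An alternating 3-form in dimension 3 is the
    determinant of the coordinates of its arguments times its value at
    [(e0, e1, e2)]; here that value is [mu e1 e2], because [phi] is [1] on [e0]
    and [0] on [e1] and [e2]. *)
Lemma wedge_coord0 (K : fieldType) (A : vectType K)
    (mu : {bilinear A -> A -> A}) :
    skew_symmetric mu -> (forall x, mu x x = 0) ->
  forall (e : 3.-tuple A), basis_of {:A} e ->
  forall x y z : A, exists d : K,
  coord e ord0 z *: mu x y + coord e ord0 x *: mu y z
    + coord e ord0 y *: mu z x = d *: mu e`_1 e`_2.
Proof.
move=> skew diag e be x y z.
have dec u : u = coord e ord0 u *: e`_0 + coord e (inord 1) u *: e`_1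
                 + coord e (inord 2) u *: e`_2.
  rewrite {1}(coord_basis be (memvf u)) !big_ord_recl big_ord0 addr0 addrA /=.
  by congr (_ + coord e _ u *: _ + coord e _ u *: _); apply: val_inj;
     rewrite /= inordK.
move: (dec x) (dec y) (dec z).
set a0 := coord e ord0 x; set a1 := coord e _ x; set a2 := coord e _ x.
set b0 := coord e ord0 y; set b1 := coord e _ y; set b2 := coord e _ y.
set c0 := coord e ord0 z; set c1 := coord e _ z; set c2 := coord e _ z.
move=> -> -> ->; rewrite !skew_expand3 //.
(* The determinant, expanded along the first coordinates. *)
exists (c0 * (a1 * b2 - a2 * b1) + a0 * (b1 * c2 - b2 * c1)
        + b0 * (c1 * a2 - c2 * a1)).
apply: vect_eq_coord => phi; rewrite !(linearD phi, scalarZ phi).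
ring.
Qed.

Definition rank1 (K : fieldType) (A : vectType K) (phi : {scalar A}) (v x : A) :=
  phi x *: v.

Lemma rank1_is_linear (K : fieldType) (A : vectType K) (phi : {scalar A})
  (v : A) : linear (rank1 phi v).
Proof. by move=> a x y; rewrite /rank1 scalarP scalerDl scalerA. Qed.

HB.instance Definition _ (K : fieldType) (A : vectType K) (phi : {scalar A})
    (v : A) :=
  GRing.isLinear.Build K A A *:%R (rank1 phi v) (@rank1_is_linear K A phi v).

Theorem theorem2 (K : fieldType) (charK0 : [pchar K] =i pred0)
    (A : vectType K) (dimA : \dim {:A} = 3%N)
    (mu : {bilinear A -> A -> A}) (mu_skew : skew_symmetric mu) :
  hom_lie mu.
Proof.
have K2 : 2%:R != 0 :> K by rewrite (iffLR (pcharf0P K) charK0).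
have diag := skew_diag K2 mu_skew.
have [e be] : exists e : 3.-tuple A, basis_of {:A} e.
  by have := vbasisP {:A}; move: (vbasis _); rewrite dimA => e be; exists e.
have e0 : coord e ord0 e`_0 = 1.
  by rewrite (coord_free ord0 ord0) ?eqxx // (basis_free be).
(* A nonzero [v] is needed even when the 3-form vanishes. *)
have [v v0 [c mu12]] : exists2 v : A, v != 0 & exists c, mu e`_1 e`_2 = c *: v.
  have [mu0|mu0] := eqVneq (mu e`_1 e`_2) 0.
    exists e`_0; last by exists 0; rewrite scale0r.
    by apply: contraTneq (oner_neq0 K) => e00; rewrite -e0 e00 linear0 eqxx.
  by exists (mu e`_1 e`_2) => //; exists 1; rewrite scale1r.
have [f fE] : exists f : 'End(A), forall x, f x = coord e ord0 x *: v.
  by exists (linfun (rank1 (coord e ord0) v)) => x; rewrite lfunE.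
split=> //; exists f; split.
  apply: contraNneq v0 => f0; have := fE e`_0.
  by rewrite f0 lfunE /= e0 scale1r => <-.
move=> x y z; have [d wE] := wedge_coord0 mu_skew diag be x y z.
have : mu (d *: mu e`_1 e`_2) v = 0.
  by rewrite mu12 !linearZl_LR /= diag !scaler0.
by rewrite -wE !linearDl !linearZl_LR !fE !linearZr_LR.
Qed.
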